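(* Let $\alpha\in\mathbb{N}\cup\{0\}$. Then there exist a constant $c>0$, a constant $c_1>0$, a sequence of smooth functions $h_k$ on $B_1$, and a sequence of solutions $u_k$ of $$\Delta u_k+|x|^{2\alpha}h_k(x)e^{u_k(x)}=0\quad\text{in } B_1$$ such that: (i) $\frac{1}{c_1}\le h_k(x)\le c_1$ and $|\nabla^{\beta}h_k(x)|\le c_1$ for all $x\in B_1$ and all multi-indices $|\beta|=1,2,3$; (ii) $|\Delta(\log h_k)(0)|\ge c$ for all $k$; (iii) $\{u_k\}$ is a blow-up sequence whose only blow-up point in $B_1$ is the origin, and it is simple, i.e. it satisfies the spherical Harnack inequality around the origin; (iv) there is $C>0$ independent of $k$ with $|u_k(x)-u_k(y)|\le C$ for all $x,y\in\partial B_1$, and $\int_{B_1}|x|^{2\alpha}h_k(x)e^{u_k(x)}\,dx\le C$.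
   Context: $B_1$ is the open unit disk in $\mathbb{R}^2$. A sequence $\{u_k\}$ is a blow-up sequence with the origin as its only blow-up point in $B_1$ if there are points $x_k\to 0$ with $u_k(x_k)\to+\infty$, while for every compact $K\subset\overline{B_1}\setminus\{0\}$ the functions $u_k$ are uniformly bounded above on $K$. The sequence satisfies the spherical Harnack inequality around the origin (is ''simple'') if there is a constant $C>0$ independent of $k$ and $r$ such that $|u_k(x)-u_k(y)|\le C$ whenever $|x|=|y|=r\in(0,1)$; a blow-up sequence violating this is called non-simple. *)

(* Defs.v *)
From Stdlib Require Import Reals Lra List.
From Coquelicot Require Import Coquelicot.
Open Scope R_scope.

Definition inB1 (x y : R) : Prop := x ^ 2 + y ^ 2 < 1.
Definition inB1bar (x y : R) : Prop := x ^ 2 + y ^ 2 <= 1.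

Definition dx (f : R -> R -> R) : R -> R -> R := fun x y => Derive (fun t => f t y) x.
Definition dy (f : R -> R -> R) : R -> R -> R := fun x y => Derive (fun t => f x t) y.

Fixpoint pderiv (l : list bool) (f : R -> R -> R) : R -> R -> R :=
  match l with
  | nil => f
  | b :: l' => (if b then dx else dy) (pderiv l' f)
  end.

Definition lap (f : R -> R -> R) : R -> R -> R :=
  fun x y => dx (dx f) x y + dy (dy f) x y.

Definition cont2_at (f : R -> R -> R) (x y : R) : Prop :=
  continuous (fun p : R * R => f (fst p) (snd p)) (x, y).

Definition cont2_within (D : R -> R -> Prop) (f : R -> R -> R) (x y : R) : Prop :=
  filterlim (fun p : R * R => f (fst p) (snd p))
            (within (fun p : R * R => D (fst p) (snd p)) (locally (x, y)))
            (locally (f x y)).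

Fixpoint Ck_on (D : R -> R -> Prop) (n : nat) (f : R -> R -> R) : Prop :=
  match n with
  | O => forall x y, D x y -> cont2_at f x y
  | S m => (forall x y, D x y ->
              ex_derive (fun t => f t y) x /\ ex_derive (fun t => f x t) y)
           /\ (forall x y, D x y -> cont2_at f x y)
           /\ Ck_on D m (dx f) /\ Ck_on D m (dy f)
  end.

Definition smooth_on (D : R -> R -> Prop) (f : R -> R -> R) : Prop :=
  forall n, Ck_on D n f.

Definition int_B1 (f : R -> R -> R) : R :=
  RInt (fun x => RInt (fun y => f x y) (- sqrt (1 - x ^ 2)) (sqrt (1 - x ^ 2))) (-1) 1.

Definition blowup_only_at_origin (u : nat -> R -> R -> R) : Prop :=
  (exists px py : nat -> R,
      (forall k, inB1 (px k) (py k)) /\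
      is_lim_seq px (Finite 0) /\ is_lim_seq py (Finite 0) /\
      is_lim_seq (fun k => u k (px k) (py k)) p_infty) /\
  (forall r : R, 0 < r ->
     exists M : R, forall k x y, r ^ 2 <= x ^ 2 + y ^ 2 <= 1 -> u k x y <= M).

Definition spherical_harnack (u : nat -> R -> R -> R) : Prop :=
  exists C : R, 0 < C /\
    forall k (r x1 y1 x2 y2 : R), 0 < r < 1 ->
      x1 ^ 2 + y1 ^ 2 = r ^ 2 -> x2 ^ 2 + y2 ^ 2 = r ^ 2 ->
      Rabs (u k x1 y1 - u k x2 y2) <= C.

(* Main.v *)
(* The weight can be taken radial and independent of k: h(x) = 1 + |x|^2, for which
   Delta (log h)(0) = 4.  With s = |x|^2 and n = alpha + 1, let u_k(x) = g_k(s) where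
   4 (s g')' + s^alpha (1 + s) e^g = 0 and g_k(0) = k; radial functions trivially satisfy the
   spherical Harnack inequality.  The singular equation is regularised by writing it as
   g' = - s^alpha M / 4 with M(s) = int_0^1 th^alpha f(s th) dth and f(r) = (1 + r) e^g(r), and
   solved by Picard iteration.

   Since the weight is nondecreasing in s, the Pohozaev quantity is nonnegative, which says
   exactly that N = M e^(-g/2) is nondecreasing.  As (e^(-g/2))' = s^alpha N / 8, this gives
   comparison with the standard bubble,
     e^(g_k(s)) <= e^k / (1 + e^k s^n / (8 n^2))^2,
   so u_k stays bounded above away from the origin.  For the mass, the bubble density is at most
   a constant times d^2 / (d^2 + |x|^2)^2 with d = e^(-k/(2n)), hence at most a constant times the
   product of d / (d^2 + x^2) and d / (d^2 + y^2), each of integral at most pi. *)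
Require Import Defs.
From Stdlib Require Import Reals Lra Lia List FunctionalExtensionality IndefiniteDescription.
From Coquelicot Require Import Coquelicot.
Open Scope R_scope.

(** * Continuity of real-valued expressions *)

Lemma continuity_2d_continuous (f : R -> R -> R) (x y : R) :
  continuous (fun p : R * R => f (fst p) (snd p)) (x, y) ->
  continuity_2d_pt f x y.
Proof. intros H. apply continuity_2d_pt_filterlim. exact H. Qed.

(** This and the next lemmas are phrased with the operations of [R] instead of those of an abstract
    normed module, so that [continuity_step] can select them by head symbol. *)
Lemma continuous_R_plus {U : UniformSpace} (f g : U -> R) (x : U) :
  continuous f x -> continuous g x -> continuous (fun y => f y + g y) x.
Proof. exact (continuous_plus f g x). Qed.

Lemma continuous_R_minus {U : UniformSpace} (f g : U -> R) (x : U) :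
  continuous f x -> continuous g x -> continuous (fun y => f y - g y) x.
Proof. exact (continuous_minus f g x). Qed.

Lemma continuous_R_opp {U : UniformSpace} (f : U -> R) (x : U) :
  continuous f x -> continuous (fun y => - f y) x.
Proof. exact (continuous_opp f x). Qed.

Lemma continuous_R_mult {U : UniformSpace} (f g : U -> R) (x : U) :
  continuous f x -> continuous g x -> continuous (fun y => f y * g y) x.
Proof. exact (continuous_mult f g x). Qed.

Lemma continuous_R_pow {U : UniformSpace} (f : U -> R) (n : nat) (x : U) :
  continuous f x -> continuous (fun y => f y ^ n) x.
Proof.
  intros Hf; induction n as [|n IH]; simpl.
  - apply continuous_const.
  - now apply continuous_R_mult.
Qed.

Lemma derive_continuous (f : R -> R) (x l : R) : is_derive f x l -> continuous f x.
Proof. intros H; apply (ex_derive_continuous f); now exists l. Qed.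

(** Functions known to be continuous everywhere are taken from the context. A quotient is treated as
    a product, which closes by itself when the denominator is constant. *)
Ltac continuity_step :=
  cbv beta;
  match goal with
  | |- continuous (Rplus ?c) ?x => change (continuous (fun y => c + y) x)
  | |- continuous (Rmult ?c) ?x => change (continuous (fun y => c * y) x)
  | |- continuous (fun _ => ?c) _ => apply continuous_const
  | |- continuous (fun y => y) _ => apply continuous_id
  | |- continuous fst _ => apply continuous_fst
  | |- continuous snd _ => apply continuous_snd
  | |- continuous (fun y => fst y) _ => apply continuous_fst
  | |- continuous (fun y => snd y) _ => apply continuous_snd
  | |- continuous (fun y => _ + _) _ => apply continuous_R_plus
  | |- continuous (fun y => _ - _) _ => apply continuous_R_minus
  | |- continuous (fun y => _ * _) _ => apply continuous_R_mult
  | |- continuous (fun y => _ / _) _ => apply continuous_R_mult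
  | |- continuous (fun y => - _) _ => apply continuous_R_opp
  | |- continuous (fun y => _ ^ _) _ => apply continuous_R_pow
  | H : forall x, continuous ?f x |- continuous (fun y => ?f (@?g y)) _ =>
      apply (continuous_comp g f); [ | apply H ]
  | H : forall x, continuous ?f x |- continuous ?f _ => apply H
  | |- continuous (fun y => exp (@?g y)) _ =>
      apply (continuous_comp g exp);
      [ | apply (ex_derive_continuous exp); auto_derive; exact I ]
  end.
Ltac continuity_tac := repeat continuity_step.

(** * Integrals depending on a parameter and averages with a power weight *)

Lemma ex_RInt_of_continuous (f : R -> R) (a b : R) :
  (forall x, continuous f x) -> ex_RInt f a b.
Proof. intros H; apply (ex_RInt_continuous f); intros; apply H. Qed.

(** Uniform continuity along the compact segment above [x] makes the integrands uniformly close. The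
    case [a <= b] comes first; the other orientation changes only the sign. *)
Lemma continuous_RInt_param (phi : R -> R -> R) (a b : R) :
  (forall x t, continuous (fun p : R * R => phi (fst p) (snd p)) (x, t)) ->
  forall x, continuous (fun x => RInt (phi x) a b) x.
Proof.
  intros H.
  assert (Hs : forall x t, continuous (phi x) t).
  { intros x t. apply (continuous_comp_2 (fun _ => x) (fun t => t) phi).
    - apply continuous_const.
    - apply continuous_id.
    - apply H. }
  assert (Hle : forall a b, a <= b -> forall x, continuous (fun x => RInt (phi x) a b) x).
  { clear a b; intros a b Hab x.
    apply filterlim_locally; intros eps.
    (* Dividing by [b - a + 1] instead of [b - a] also covers [a = b]. *)
    assert (He : 0 < eps / 2 / (b - a + 1)).
    { apply Rdiv_lt_0_compat; [destruct eps; simpl; lra | lra]. }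
    destruct (uniform_continuity_2d_1d' phi a b x
      (fun t _ => continuity_2d_continuous _ _ _ (H x t)) (mkposreal _ He)) as [d Hd].
    exists d; intros y Hy. change (Rabs (y - x) < d) in Hy.
    change (Rabs (RInt (phi y) a b - RInt (phi x) a b) < eps).
    rewrite <- (RInt_minus (phi y) (phi x)); try (now apply ex_RInt_of_continuous).
    apply Rle_lt_trans with ((b - a) * (eps / 2 / (b - a + 1))).
    - apply abs_RInt_le_const; [exact Hab | |].
      + apply (ex_RInt_minus (phi y) (phi x)); now apply ex_RInt_of_continuous.
      + intros t Ht. apply Rlt_le. apply (Hd t x t y); try lra.
        * destruct d; simpl in *; lra.
        * apply Rabs_def2 in Hy; lra.
        * rewrite Rminus_diag, Rabs_R0; apply cond_pos.
    - destruct eps as [e He']; simpl in *.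
      assert (0 < e / 2 / (b - a + 1) ) by exact He.
      replace e with (2 * ((b - a + 1) * (e / 2 / (b - a + 1)))) at 2 by (field; lra).
      nra. }
  intros x. destruct (Rle_dec a b) as [Hab|Hab]; [now apply Hle|].
  apply (continuous_ext (fun x => - RInt (phi x) b a)).
  - intros y. apply (opp_RInt_swap (phi y)). now apply ex_RInt_of_continuous.
  - apply continuous_R_opp, Hle; lra.
Qed.

(** By [r = s th], [s^(a+1) * avg a f s] is the integral of [r^a * f r] over [[0, s]]. The scaled
    form involves no division by [s] and is regular at [s = 0]. *)
Definition avg (a : nat) (f : R -> R) (s : R) : R :=
  RInt (fun th => th ^ a * f (s * th)) 0 1.

Lemma avg_continuous (a : nat) (f : R -> R) :
  (forall x, continuous f x) -> forall s, continuous (avg a f) s.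
Proof.
  intros Hf. apply (continuous_RInt_param (fun s th => th ^ a * f (s * th))).
  intros; continuity_tac.
Qed.

(** Differentiation under the integral sign brings out one factor [th], which raises the index. *)
Lemma avg_derive (a : nat) (f f1 : R -> R) :
  (forall x, is_derive f x (f1 x)) -> (forall x, continuous f1 x) ->
  forall s, is_derive (avg a f) s (avg (S a) f1 s).
Proof.
  intros Hd Hc s.
  assert (Hf : forall x, continuous f x) by (intros x; eapply derive_continuous; apply Hd).
  assert (HD : forall x t, is_derive (fun u => t ^ a * f (u * t)) x (t ^ S a * f1 (x * t))).
  { intros x t. auto_derive.
    - exists (f1 (x * t)); apply Hd.
    - rewrite (is_derive_unique (fun y : R => f y) _ _ (Hd (x * t)) : Derive (fun y : R => f y) (x * t) = _). simpl; ring. }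
  unfold avg.
  rewrite <- (RInt_ext (fun t => Derive (fun u => t ^ a * f (u * t)) s)).
  2: intros t _; now apply is_derive_unique.
  apply (is_derive_RInt_param (fun s th => th ^ a * f (s * th))).
  - apply filter_forall; intros x t _; eexists; apply HD.
  - intros t _. apply continuity_2d_continuous.
    apply (continuous_ext (fun p : R * R => snd p ^ S a * f1 (fst p * snd p))).
    + intros p; symmetry; now apply is_derive_unique.
    + continuity_tac.
  - apply filter_forall; intros y. apply ex_RInt_of_continuous. intros; continuity_tac.
Qed.

(* The identity is [f s] = integral over [0,1] of the derivative of [th^(a+1) f (s th)]. *)
Lemma avg_by_parts (a : nat) (f f1 : R -> R) (s : R) :
  (forall x, is_derive f x (f1 x)) -> (forall x, continuous f1 x) ->
  s * avg (S a) f1 s + INR (S a) * avg a f s = f s.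
Proof.
  intros Hd Hc.
  assert (Hf : forall x, continuous f x) by (intros x; eapply derive_continuous; apply Hd).
  unfold avg.
  change (scal s (RInt (fun th => th ^ S a * f1 (s * th)) 0 1) +
          scal (INR (S a)) (RInt (fun th => th ^ a * f (s * th)) 0 1) = f s).
  rewrite <- !RInt_scal by (apply ex_RInt_of_continuous; intros; continuity_tac).
  change (plus (RInt (fun x => scal s (x ^ S a * f1 (s * x))) 0 1)
    (RInt (fun x => scal (INR (S a)) (x ^ a * f (s * x))) 0 1) = f s).
  rewrite <- RInt_plus.
  2,3: apply ex_RInt_of_continuous; intros; unfold scal; simpl; unfold mult; simpl;
       continuity_tac.
  apply is_RInt_unique.
  replace (f s) with (minus (1 ^ S a * f (s * 1)) (0 ^ S a * f (s * 0))).
  2:{ unfold minus, plus, opp; simpl. rewrite pow1, (Rmult_1_r s). ring. }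
  apply (is_RInt_derive (fun th => th ^ S a * f (s * th))).
  - intros t _. auto_derive.
    + exists (f1 (s * t)); apply Hd.
    + rewrite (is_derive_unique (fun y : R => f y) _ _ (Hd (s * t)) : Derive (fun y : R => f y) (s * t) = _).
      change (Init.Nat.pred (S a)) with a.
      unfold plus, scal; simpl; unfold mult; simpl. ring.
  - intros t _. unfold plus, scal; simpl; unfold mult; simpl. continuity_tac.
Qed.

(** * Fixed points of contractions in a weighted norm *)

(** Contraction principle with ratio 1/2 for the norm [sup |f| / w], expressed by pointwise bounds.
    Functions of infinite norm are allowed: only the first increment has to be finite, and all later
    ones decay geometrically from it. *)
Lemma weighted_fixed_point (T : (R -> R) -> R -> R) (w g0 : R -> R) (A0 : R) :
  (forall x, continuous w x) -> (forall x, 0 < w x) -> (forall x, continuous g0 x) ->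
  (forall f, (forall x, continuous f x) -> forall x, continuous (T f) x) ->
  (forall f g A, 0 <= A -> (forall x, continuous f x) -> (forall x, continuous g x) ->
     (forall s, Rabs (f s - g s) <= A * w s) ->
     forall s, Rabs (T f s - T g s) <= A / 2 * w s) ->
  0 <= A0 -> (forall s, Rabs (T g0 s - g0 s) <= A0 * w s) ->
  exists g, (forall x, continuous g x) /\ forall s, g s = T g s.
Proof.
  intros Hw Hwp Hg0 HTc HT HA0 Hstart.
  set (G := fix G n := match n with O => g0 | S n => T (G n) end).
  assert (HGc : forall n x, continuous (G n) x).
  { induction n; [exact Hg0 | now apply HTc]. }
  assert (Hp : forall n, 0 < (/ 2) ^ n) by (intros; apply pow_lt; lra).
  assert (Hstep : forall n s, Rabs (G (S n) s - G n s) <= A0 * (/ 2) ^ n * w s).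
  { induction n; intros s.
    - simpl. rewrite Rmult_1_r. apply Hstart.
    - change (Rabs (T (G (S n)) s - T (G n) s) <= A0 * (/ 2) ^ (S n) * w s).
      replace (A0 * (/ 2) ^ S n) with (A0 * (/ 2) ^ n / 2) by (simpl; field).
      apply HT; auto. specialize (Hp n); nra. }
  (* The exact geometric sum, unlike its bound [2 * A0 * (/ 2)^n], is preserved by the induction on
     [m]. *)
  assert (Htail : forall n m s, Rabs (G (n + m)%nat s - G n s)
            <= 2 * A0 * ((/ 2) ^ n - (/ 2) ^ (n + m)) * w s).
  { intros n m s. induction m.
    - rewrite Nat.add_0_r, Rminus_diag, Rabs_R0. lra.
    - rewrite Nat.add_succ_r.
      replace (G (S (n + m)) s - G n s)
        with ((G (S (n + m)) s - G (n + m)%nat s) + (G (n + m)%nat s - G n s)) by ring.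
      eapply Rle_trans; [apply Rabs_triang|].
      specialize (Hstep (n + m)%nat s). simpl pow. nra. }
  assert (Hlim : forall s, ex_finite_lim_seq (fun n => G n s)).
  { intros s. apply ex_lim_seq_cauchy_corr. intros eps.
    assert (Hl : is_lim_seq (fun n => (2 * A0 * w s) * (/ 2) ^ n) 0).
    { replace (Finite 0) with (Rbar_mult (2 * A0 * w s) 0).
      2: simpl; f_equal; ring.
      apply is_lim_seq_scal_l, is_lim_seq_geom. rewrite Rabs_pos_eq; lra. }
    apply is_lim_seq_spec in Hl.
    destruct (Hl (pos_div_2 eps)) as [N HN].
    exists N. intros n m Hn Hm.
    assert (Hb : forall n, (N <= n)%nat -> Rabs (G n s - G N s) < eps / 2).
    { intros p Hpn. specialize (Htail N (p - N)%nat s).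
      replace (N + (p - N))%nat with p in Htail by lia.
      specialize (HN N (le_n N)). rewrite Rminus_0_r in HN.
      apply Rabs_def2 in HN. simpl in HN.
      pose proof (Hp p). pose proof (Hwp s).
      assert (0 <= A0 * (/2)^p * w s) by (repeat apply Rmult_le_pos; lra). nra. }
    pose proof (Hb n Hn) as H1. pose proof (Hb m Hm) as H2.
    apply Rabs_def2 in H1. apply Rabs_def2 in H2. apply Rabs_def1; lra. }
  set (g := fun s => real (Lim_seq (fun n => G n s))).
  assert (Hgl : forall s, is_lim_seq (fun n => G n s) (g s)).
  { intros s. now apply Lim_seq_correct'. }
  assert (Hbound : forall n s, Rabs (g s - G n s) <= 2 * A0 * (/ 2) ^ n * w s).
  { intros n s.
    assert (HL : is_lim_seq (fun m => Rabs (G (m + n)%nat s - G n s)) (Rabs (g s - G n s))).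
    { apply (is_lim_seq_abs _ (g s - G n s)).
      apply is_lim_seq_minus'; [|apply is_lim_seq_const].
      apply (is_lim_seq_incr_n (fun m => G m s) n), Hgl. }
    apply (is_lim_seq_le _ (fun _ => 2 * A0 * (/ 2) ^ n * w s) _ _ ) with (2 := HL)
      (3 := is_lim_seq_const _).
    intros m. specialize (Htail n m s). rewrite Nat.add_comm.
    pose proof (Hp (n + m)%nat). pose proof (Hwp s).
    assert (0 <= A0 * (/2)^(n+m) * w s) by (repeat apply Rmult_le_pos; lra). nra. }
  assert (Hgc : forall x, continuous g x).
  { intros x. apply continuity_pt_filterlim.
    (* Convergence is uniform only where the weight is bounded; continuity of [w] provides a ball on
       which [w < w x + 1]. *)
    destruct (proj1 (filterlim_locally (F := locally x) w (w x)) (Hw x) (mkposreal 1 Rlt_0_1))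
      as [d Hd].
    apply (CVU_continuity G g x d).
    2: intros n y _; apply continuity_pt_filterlim, HGc.
    2: unfold Boule; rewrite Rminus_diag, Rabs_R0; apply cond_pos.
    intros eps He.
    assert (Hl : is_lim_seq (fun n => (2 * A0 * (w x + 1)) * (/ 2) ^ n) 0).
    { replace (Finite 0) with (Rbar_mult (2 * A0 * (w x + 1)) 0).
      2: simpl; f_equal; ring.
      apply is_lim_seq_scal_l, is_lim_seq_geom. rewrite Rabs_pos_eq; lra. }
    apply is_lim_seq_spec in Hl.
    destruct (Hl (mkposreal eps He)) as [N HN].
    exists N. intros n y Hn Hy.
    specialize (HN n Hn). rewrite Rminus_0_r in HN. apply Rabs_def2 in HN. simpl in HN.
    eapply Rle_lt_trans; [apply Hbound|].
    assert (Hwy : w y < w x + 1).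
    { specialize (Hd y Hy). change (Rabs (w y - w x) < 1) in Hd.
      apply Rabs_def2 in Hd. lra. }
    specialize (Hp n).
    assert (0 <= A0 * (/2)^n) by (apply Rmult_le_pos; lra). nra. }
  exists g. split; [exact Hgc|]. intros s.
  (* Inserting [G (S n) = T (G n)] leaves two terms that each tend to zero, the second by the
     contraction property. *)
  assert (Hdiff : forall n, Rabs (g s - T g s) <= 2 * A0 * w s * (/ 2) ^ n).
  { intros n.
    replace (g s - T g s) with ((g s - G (S n) s) - (T g s - T (G n) s)) by (simpl; ring).
    eapply Rle_trans; [apply Rabs_triang|]. rewrite Rabs_Ropp.
    pose proof (Hbound (S n) s) as H1.
    assert (H2 : Rabs (T g s - T (G n) s) <= 2 * A0 * (/ 2) ^ n / 2 * w s).
    { apply HT; auto. specialize (Hp n); nra. }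
    simpl pow in H1. nra. }
  assert (HL : is_lim_seq (fun n => 2 * A0 * w s * (/ 2) ^ n) 0).
  { replace (Finite 0) with (Rbar_mult (2 * A0 * w s) 0).
    2: simpl; f_equal; ring.
    apply is_lim_seq_scal_l, is_lim_seq_geom. rewrite Rabs_pos_eq; lra. }
  assert (H0 : Rbar_le (Rabs (g s - T g s)) 0)
    by exact (is_lim_seq_le _ _ _ _ Hdiff (is_lim_seq_const _) HL).
  simpl in H0.
  pose proof (Rabs_pos (g s - T g s)). 
  assert (Hz : Rabs (g s - T g s) = 0) by lra.
  destruct (Req_dec (g s - T g s) 0) as [Hz'|Hz']; [lra|].
  apply Rabs_no_R0 in Hz'. contradiction.
Qed.

(** * The truncated exponential *)

Lemma RInt_upper_derive (f : R -> R) (a x : R) :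
  (forall x, continuous f x) -> is_derive (RInt f a) x (f x).
Proof.
  intros Hf. apply (is_derive_RInt f _ a); [|apply Hf].
  apply filter_forall; intros z.
  now apply (RInt_correct f a z), ex_RInt_of_continuous.
Qed.

(* Equal to [exp] on [y <= K] and affine with slope [exp K] beyond, hence C^1 and Lipschitz. *)
Definition truncated_exp (K y : R) : R := exp K + RInt (fun t => exp (Rmin t K)) K y.

Lemma exp_Rmin_continuous (K y : R) : continuous (fun t => exp (Rmin t K)) y.
Proof.
  apply (continuous_ext (fun t => exp ((t + K - Rabs (t - K)) / 2))).
  - intros t; f_equal; unfold Rmin, Rabs.
    destruct (Rle_dec t K); destruct (Rcase_abs (t - K)); lra.
  - continuity_tac. apply (continuous_comp (fun t => t - K) Rabs).
    + continuity_tac.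
    + apply continuous_Rabs.
Qed.

Lemma truncated_exp_derive (K y : R) :
  is_derive (truncated_exp K) y (exp (Rmin y K)).
Proof.
  replace (exp (Rmin y K)) with (0 + exp (Rmin y K)) by ring.
  apply (is_derive_plus (fun _ => exp K) (RInt (fun t => exp (Rmin t K)) K)).
  - apply (is_derive_const (exp K)).
  - apply (RInt_upper_derive (fun t => exp (Rmin t K))), exp_Rmin_continuous.
Qed.

Lemma truncated_exp_eq (K y : R) : y <= K -> truncated_exp K y = exp y.
Proof.
  intros Hy. unfold truncated_exp.
  rewrite (RInt_ext _ exp).
  - rewrite (is_RInt_unique _ K y (exp y - exp K)); [ring|].
    apply (is_RInt_derive exp exp).
    + intros x _; apply is_derive_exp.
    + intros x _; continuity_tac. apply continuous_exp.
  - intros t. rewrite Rmin_right, Rmax_left by lra. intros Ht.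
    now rewrite Rmin_left by lra.
Qed.

Lemma truncated_exp_pos (K y : R) : 0 < truncated_exp K y.
Proof.
  destruct (Rle_dec y K) as [H|H].
  - rewrite truncated_exp_eq by exact H. apply exp_pos.
  - unfold truncated_exp. pose proof (exp_pos K).
    assert (0 <= RInt (fun t => exp (Rmin t K)) K y); [|lra].
    apply RInt_ge_0; [lra| |].
    + apply ex_RInt_of_continuous, exp_Rmin_continuous.
    + intros; apply Rlt_le, exp_pos.
Qed.

Lemma truncated_exp_lipschitz (K y z : R) :
  Rabs (truncated_exp K y - truncated_exp K z) <= exp K * Rabs (y - z).
Proof.
  destruct (MVT_gen (truncated_exp K) z y (fun t => exp (Rmin t K))) as [c [_ Hc]].
  - intros; apply truncated_exp_derive.
  - intros x _. apply continuity_pt_filterlim.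
    exact (derive_continuous _ _ _ (truncated_exp_derive K x)).
  - rewrite Hc, Rabs_mult. apply Rmult_le_compat_r; [apply Rabs_pos|].
    rewrite Rabs_pos_eq by apply Rlt_le, exp_pos.
    destruct (Rle_lt_or_eq_dec _ _ (Rmin_r c K)) as [H|H].
    + now apply Rlt_le, exp_increasing.
    + rewrite H; lra.
Qed.

Lemma truncated_exp_continuous (K y : R) : continuous (truncated_exp K) y.
Proof. exact (derive_continuous _ _ _ (truncated_exp_derive K y)). Qed.

(** * Global solution of the radial equation by Picard iteration *)

Lemma avg_bound (a : nat) (f : R -> R) (s B : R) :
  (forall x, continuous f x) ->
  (forall th, 0 <= th <= 1 -> Rabs (f (s * th)) <= B) ->
  Rabs (avg a f s) <= B.
Proof.
  intros Hf HB. replace B with ((1 - 0) * B) by ring.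
  apply abs_RInt_le_const; [lra| |].
  - apply ex_RInt_of_continuous. intros; continuity_tac.
  - intros t Ht. rewrite Rabs_mult.
    rewrite <- (Rmult_1_l B).
    apply Rmult_le_compat; try apply Rabs_pos; [|now apply HB].
    rewrite Rabs_pos_eq by (apply pow_le; lra).
    rewrite <- (pow1 a). now apply pow_incr.
Qed.

Lemma avg_minus (a : nat) (f g : R -> R) (s : R) :
  (forall x, continuous f x) -> (forall x, continuous g x) ->
  avg a (fun r => f r - g r) s = avg a f s - avg a g s.
Proof.
  intros Hf Hg. unfold avg.
  rewrite <- (RInt_minus (fun th => th ^ a * f (s * th)) (fun th => th ^ a * g (s * th))).
  - apply RInt_ext; intros t _. unfold minus, plus, opp; simpl; ring.
  - apply ex_RInt_of_continuous; intros; continuity_tac.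
  - apply ex_RInt_of_continuous; intros; continuity_tac.
Qed.

(** The majorant depends on [|x|] only, so negative [s] reduces to positive [s] by reflection. The
    Picard estimates can then treat both half-lines at once. *)
Lemma RInt_even_bound (f P p : R -> R) (s : R) :
  (forall x, continuous f x) -> (forall x, is_derive P x (p x)) ->
  (forall x, continuous p x) -> (forall x, Rabs (f x) <= p (Rabs x)) ->
  Rabs (RInt f 0 s) <= P (Rabs s) - P 0.
Proof.
  intros Hf HP Hp Hb.
  assert (Hpos : forall f s, (forall x, continuous f x) ->
    (forall x, Rabs (f x) <= p (Rabs x)) -> 0 <= s -> Rabs (RInt f 0 s) <= P s - P 0).
  { clear - HP Hp. intros f s Hf Hb Hs.
    eapply Rle_trans; [apply abs_RInt_le; [exact Hs|now apply ex_RInt_of_continuous]|].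
    rewrite <- (is_RInt_unique p 0 s (P s - P 0)).
    2: apply (is_RInt_derive P p); intros; auto.
    apply RInt_le; [exact Hs| | now apply ex_RInt_of_continuous|].
    - apply (ex_RInt_of_continuous (fun x => Rabs (f x))). intros x.
      apply (continuous_comp f Rabs); [apply Hf|apply continuous_Rabs].
    - intros x Hx. specialize (Hb x). now rewrite (Rabs_pos_eq x) in Hb by lra. }
  destruct (Rle_dec 0 s) as [Hs|Hs].
  - rewrite (Rabs_pos_eq s) by exact Hs. now apply Hpos.
  - rewrite (Rabs_left s) by lra.
    replace (RInt f 0 s) with (RInt (fun y => - f (- y)) 0 (- s)).
    + apply (Hpos (fun y => - f (- y))); [| |lra].
      * intros; continuity_tac.
      * intros x. rewrite Rabs_Ropp, <- (Rabs_Ropp x). apply Hb.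
    + replace s with (- - s) at 2 by ring. rewrite <- Ropp_0 at 2.
      rewrite <- (RInt_comp f Ropp (fun _ => -1)).
      * apply RInt_ext; intros x _. unfold scal; simpl; unfold mult; simpl; ring.
      * intros x _; apply Hf.
      * intros x _; split; [auto_derive; [exact I|ring]|apply continuous_const].
Qed.

(* The nonlinearity is truncated so that negative [r] needs no separate treatment; the
   solutions stay below [K] for [r >= 0], where the truncation is inactive. *)
Definition source (K : R) (g : R -> R) (r : R) : R := (1 + r) * truncated_exp K (g r).

Lemma source_continuous (K : R) (g : R -> R) :
  (forall x, continuous g x) -> forall x, continuous (source K g) x.
Proof.
  intros Hg x. unfold source. pose proof (truncated_exp_continuous K).
  continuity_tac.
Qed.

(* Picard iteration converges on the whole line in the norm weighted by [exp (W |s|)],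
   where [W'] is twice the Lipschitz density of the integral operator. *)
Lemma radial_equation_solution (a : nat) (K : R) :
  exists g, g 0 = K /\
    forall s, is_derive g s (- (s ^ a * avg a (source K g) s / 4)).
Proof.
  set (integrand := fun g t => t ^ a * avg a (source K g) t / 4).
  assert (Hic : forall g, (forall x, continuous g x) -> forall x, continuous (integrand g) x).
  { intros g Hg x. unfold integrand.
    pose proof (avg_continuous a _ (source_continuous K g Hg)). continuity_tac. }
  set (T := fun g s => K - RInt (integrand g) 0 s).
  set (W := fun s => exp K / 2 * (s ^ S a / INR (S a) + s ^ S (S a) / INR (S (S a)))).
  set (W1 := fun s => exp K / 2 * (s ^ a * (1 + s))).
  assert (Hn1 : INR (S a) <> 0) by (apply not_0_INR; discriminate).
  assert (Hn2 : INR (S (S a)) <> 0) by (apply not_0_INR; discriminate).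
  assert (HW : forall x, is_derive W x (W1 x)).
  { intros x. unfold W, W1. auto_derive; [exact I|].
    change (Init.Nat.pred (S (S a))) with (S a). change (Init.Nat.pred (S a)) with a.
    change (pow x (S a)) with (x * pow x a).
    change (match a with O => 1 | S _ => INR a + 1 end) with (INR (S a)).
    change (INR (S a) + 1) with (INR (S (S a))).
    field; auto. }
  assert (HW1c : forall x, continuous W1 x) by (intros; unfold W1; continuity_tac).
  assert (HWc : forall x, continuous W x) by (intros; eapply derive_continuous; apply HW).
  assert (Hmono : forall x y, 0 <= x <= y -> W x <= W y).
  { intros x y Hxy. unfold W.
    assert (0 < INR (S a)) by (apply lt_0_INR; lia).
    assert (0 < INR (S (S a))) by (apply lt_0_INR; lia).
    pose proof (exp_pos K).
    apply Rmult_le_compat_l; [lra|].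
    apply Rplus_le_compat; apply Rmult_le_compat_r.
    all: try (apply Rlt_le, Rinv_0_lt_compat; assumption).
    all: now apply pow_incr. }
  assert (HW0 : W 0 = 0) by (unfold W; rewrite !pow_i by lia; field; auto).
  assert (Hexp : forall x y, x <= y -> exp x <= exp y).
  { intros x y [H|H]; [now apply Rlt_le, exp_increasing | rewrite H; lra]. }
  assert (Habsth : forall s th, 0 <= th <= 1 -> Rabs (s * th) <= Rabs s).
  { intros s th Hth. rewrite Rabs_mult, (Rabs_pos_eq th) by lra.
    pose proof (Rabs_pos s). nra. }
  assert (Hone : forall r, Rabs (1 + r) <= 1 + Rabs r).
  { intros r. eapply Rle_trans; [apply Rabs_triang|]. rewrite Rabs_R1; lra. }
  destruct (weighted_fixed_point T (fun s => exp (W (Rabs s))) (fun _ => K) 1) as [g [Hgc Hg]].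
  - intros x. pose proof continuous_Rabs. continuity_tac.
  - intros; apply exp_pos.
  - intros; continuity_tac.
  - intros f Hf x. unfold T. continuity_tac.
    exact (derive_continuous _ _ _ (RInt_upper_derive _ 0 x (Hic f Hf))).
  - intros f g A HA Hf Hg Hfg s. unfold T.
    replace (K - RInt (integrand f) 0 s - (K - RInt (integrand g) 0 s))
      with (- (RInt (integrand f) 0 s - RInt (integrand g) 0 s)) by ring.
    rewrite Rabs_Ropp.
    assert (HM : RInt (fun t => integrand f t - integrand g t) 0 s
                 = RInt (integrand f) 0 s - RInt (integrand g) 0 s).
    { apply (RInt_minus (integrand f) (integrand g)); now apply ex_RInt_of_continuous, Hic. }
    rewrite <- HM.
    eapply Rle_trans.
    + apply (RInt_even_bound _ (fun x => A / 2 * exp (W x))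
        (fun x => A / 2 * (W1 x * exp (W x)))).
      * intros x. apply continuous_R_minus; now apply Hic.
      * intros x. auto_derive; [exists (W1 x); apply HW|].
        rewrite (is_derive_unique (fun y : R => W y) _ _ (HW x)
                  : Derive (fun y : R => W y) x = _). ring.
      * intros x. continuity_tac.
      * intros x. unfold integrand.
        replace (x ^ a * avg a (source K f) x / 4 - x ^ a * avg a (source K g) x / 4)
          with (x ^ a * (avg a (source K f) x - avg a (source K g) x) / 4) by field.
        rewrite <- avg_minus by now apply source_continuous.
        unfold Rdiv at 1. rewrite !Rabs_mult, <- RPow_abs, (Rabs_pos_eq (/ 4)) by lra.
        replace (A / 2 * (W1 (Rabs x) * exp (W (Rabs x))))
          with (Rabs x ^ a * ((1 + Rabs x) * (exp K * (A * exp (W (Rabs x))))) * / 4)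
          by (unfold W1; field).
        apply Rmult_le_compat_r; [lra|].
        apply Rmult_le_compat_l; [apply pow_le, Rabs_pos|].
        apply avg_bound.
        { intros; apply continuous_R_minus; now apply source_continuous. }
        intros th Hth. unfold source.
        rewrite <- Rmult_minus_distr_l, Rabs_mult.
        apply Rmult_le_compat; try apply Rabs_pos.
        { eapply Rle_trans; [apply Hone|]. specialize (Habsth x th Hth). lra. }
        eapply Rle_trans; [apply truncated_exp_lipschitz|].
        apply Rmult_le_compat_l; [apply Rlt_le, exp_pos|].
        eapply Rle_trans; [apply Hfg|].
        apply Rmult_le_compat_l; [exact HA|].
        apply Hexp, Hmono. split; [apply Rabs_pos|now apply Habsth].
    + pose proof (exp_pos (W 0)). nra.
  - lra.
  - intros s. unfold T.
    replace (K - RInt (integrand (fun _ => K)) 0 s - K)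
      with (- RInt (integrand (fun _ => K)) 0 s) by ring.
    rewrite Rabs_Ropp.
    assert (HKc : forall x : R, continuous (fun _ : R => K) x)
      by (intros; apply continuous_const).
    eapply Rle_trans.
    + apply (RInt_even_bound _ (fun x => / 2 * W x) (fun x => / 2 * W1 x)).
      * now apply Hic.
      * intros x. auto_derive; [exists (W1 x); apply HW|].
        rewrite (is_derive_unique (fun y : R => W y) _ _ (HW x)
                  : Derive (fun y : R => W y) x = _). ring.
      * intros x. continuity_tac.
      * intros x. unfold integrand.
        unfold Rdiv. rewrite !Rabs_mult, <- RPow_abs, (Rabs_pos_eq (/ 4)) by lra.
        replace (/ 2 * W1 (Rabs x))
          with (Rabs x ^ a * ((1 + Rabs x) * exp K) * / 4)
          by (unfold W1; field).
        apply Rmult_le_compat_r; [lra|].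
        apply Rmult_le_compat_l; [apply pow_le, Rabs_pos|].
        apply avg_bound; [now apply source_continuous|].
        intros th Hth. unfold source. rewrite Rabs_mult.
        apply Rmult_le_compat; try apply Rabs_pos.
        { eapply Rle_trans; [apply Hone|]. specialize (Habsth x th Hth). lra. }
        rewrite truncated_exp_eq by lra.
        rewrite Rabs_pos_eq by apply Rlt_le, exp_pos. lra.
    + rewrite HW0. pose proof (exp_ineq1_le (W (Rabs s))).
      assert (W 0 <= W (Rabs s)) by (apply Hmono; split; [lra|apply Rabs_pos]). lra.
  - exists g. split.
    + rewrite Hg. unfold T. rewrite RInt_point. unfold zero; simpl; ring.
    + intros s. apply (is_derive_ext (T g)); [intros; symmetry; apply Hg|].
      unfold T.
      replace (- (s ^ a * avg a (source K g) s / 4)) with (0 - integrand g s)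
        by (unfold integrand; ring).
      apply (is_derive_minus (fun _ => K) (RInt (integrand g) 0)); [|now apply RInt_upper_derive, Hic].
      apply (is_derive_const K).
Qed.

(** * The radial profile: Pohozaev monotonicity and comparison with the bubble *)

Lemma derive_nonneg_le (f f1 : R -> R) (s : R) :
  (forall x, is_derive f x (f1 x)) -> (forall x, 0 < x -> 0 <= f1 x) ->
  0 <= s -> f 0 <= f s.
Proof.
  intros Hd Hp [Hs|<-]; [|lra].
  destruct (MVT_cor2 f f1 0 s Hs) as [c [Hc Hc0]].
  - intros; apply is_derive_Reals, Hd.
  - specialize (Hp c (proj1 Hc0)). nra.
Qed.

(** The derivatives are given on the whole line, so that composing with [x^2 + y^2] needs no
    one-sided argument at the origin. The equation is claimed only for [s >= 0], where the
    truncation is inactive. *)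
Lemma radial_solution (a : nat) (K : R) :
  exists g g1 g2 : R -> R,
    g 0 = K /\
    (forall s, is_derive g s (g1 s)) /\ (forall s, is_derive g1 s (g2 s)) /\
    (forall s, continuous g2 s) /\
    (forall s, 0 <= s -> 4 * (g1 s + s * g2 s) + s ^ a * (1 + s) * exp (g s) = 0) /\
    (forall s, 0 <= s ->
       exp (g s) <= exp K / (1 + exp K * s ^ S a / (8 * INR (S a) ^ 2)) ^ 2).
Proof.
  destruct (radial_equation_solution a K) as [g [Hg0 Hg]].
  set (f := source K g) in *.
  set (M := avg a f) in *.
  set (g1 := fun s => - (s ^ a * M s / 4)) in *.
  set (f1 := fun s => truncated_exp K (g s) + (1 + s) * (exp (Rmin (g s) K) * g1 s)).
  set (M1 := avg (S a) f1).
  (* For [a = 0] the value of [pred a] is harmless because the coefficient [INR a] vanishes. *)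
  set (g2 := fun s => - ((INR a * s ^ pred a * M s + s ^ a * M1 s) / 4)).
  set (n := INR (S a)).
  assert (Hn : 0 < n) by (apply lt_0_INR; lia).
  assert (Hgc : forall x, continuous g x) by (intros x; exact (derive_continuous _ _ _ (Hg x))).
  assert (Hfc : forall x, continuous f x) by now apply source_continuous.
  assert (HMc : forall x, continuous M x) by now apply avg_continuous.
  assert (Hg1c : forall x, continuous g1 x) by (intros; unfold g1; continuity_tac).
  assert (Hf1c : forall x, continuous f1 x).
  { intros x. unfold f1. pose proof (truncated_exp_continuous K).
    apply continuous_R_plus; [continuity_tac|].
    apply continuous_R_mult; [continuity_tac|].
    apply continuous_R_mult; [|apply Hg1c].
    apply (continuous_comp g (fun t => exp (Rmin t K)));
      [apply Hgc | apply exp_Rmin_continuous]. }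
  assert (Hf1 : forall x, is_derive f x (f1 x)).
  { intros x. unfold f, source, f1.
    pose proof (is_derive_comp (truncated_exp K) g x _ _ (truncated_exp_derive K (g x)) (Hg x)) as Hc.
    pose proof (is_derive_mult (fun r => 1 + r) (fun r => truncated_exp K (g r)) x 1 _
      ltac:(auto_derive; [exact I|ring]) Hc ltac:(intros; apply Rmult_comm)) as Hm.
    replace (truncated_exp K (g x) + (1 + x) * (exp (Rmin (g x) K) * g1 x))
      with (plus (mult 1 (truncated_exp K (g x)))
             (mult (1 + x) (scal (g1 x) (exp (Rmin (g x) K))))).
    - exact Hm.
    - unfold plus, mult, scal; simpl; unfold mult; simpl. ring. }
  assert (HM1 : forall x, is_derive M x (M1 x)) by now apply avg_derive.
  assert (HM1c : forall x, continuous M1 x) by now apply avg_continuous.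
  (* For [x <> 0] this is [(x^n M)' = x^a f] divided by [x^a]: the divergence form of the equation,
     in a shape that also holds at [x = 0]. *)
  assert (Hparts : forall x, x * M1 x + n * M x = f x) by (intros; now apply avg_by_parts).
  assert (DM : forall x, Derive (fun y : R => M y) x = M1 x)
    by (intros; now apply is_derive_unique).
  assert (Dg : forall x, Derive (fun y : R => g y) x = g1 x)
    by (intros; now apply is_derive_unique).
  assert (Df : forall x, Derive (fun y : R => f y) x = f1 x)
    by (intros; now apply is_derive_unique).
  assert (EM : forall x, ex_derive (fun y : R => M y) x) by (intros x; exists (M1 x); apply HM1).
  assert (Eg : forall x, ex_derive (fun y : R => g y) x) by (intros x; exists (g1 x); apply Hg).
  assert (Ef : forall x, ex_derive (fun y : R => f y) x) by (intros x; exists (f1 x); apply Hf1).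
  assert (Hfpos : forall x, 0 <= x -> 0 <= f x).
  { intros x Hx. unfold f, source. pose proof (truncated_exp_pos K (g x)). nra. }
  assert (HMpos : forall x, 0 <= x -> 0 <= M x).
  { intros x Hx. apply RInt_ge_0; [lra| |].
    - apply ex_RInt_of_continuous; intros; continuity_tac.
    - intros t Ht. apply Rmult_le_pos; [apply pow_le; lra|apply Hfpos; nra]. }
  (* The truncated source is already nonnegative on the half-line, so [g] is nonincreasing there and
     never exceeds [g 0 = K]. No circularity arises. *)
  assert (HgK : forall x, 0 <= x -> g x <= K).
  { intros x Hx. rewrite <- Hg0.
    enough (- g 0 <= - g x) by lra.
    apply (derive_nonneg_le (fun x => - g x) (fun x => - g1 x)); [| |exact Hx].
    - intros y. apply (is_derive_opp g), Hg.
    - intros y Hy. unfold g1. pose proof (HMpos y ltac:(lra)).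
      assert (0 <= y ^ a) by (apply pow_le; lra). nra. }
  assert (Hfe : forall x, 0 <= x -> f x = (1 + x) * exp (g x)).
  { intros x Hx. unfold f, source. now rewrite truncated_exp_eq by now apply HgK. }
  assert (Hf1e : forall x, 0 <= x -> f1 x = exp (g x) + f x * g1 x).
  { intros x Hx. unfold f1. rewrite Hfe, truncated_exp_eq, Rmin_left by auto. ring. }
  (* Up to a factor 4, [Q] is the Pohozaev quantity [(s^n f + 2 p^2)/4 - n p] of
     [p = - s g'(s) = s^n M(s) / 4]. *)
  set (Q := fun s => s ^ S a * (f s - n * M s) + (s ^ S a * M s) ^ 2 / 8).
  assert (HQ : forall s, is_derive Q s
    (n * s ^ a * (f s - n * M s) + s ^ S a * (f1 s - n * M1 s)
      + s ^ S a * M s * (n * s ^ a * M s + s ^ S a * M1 s) / 4)).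
  { intros s. unfold Q. auto_derive; [auto|].
    rewrite DM, Df. change (Init.Nat.pred (S a)) with a.
    change (match a with O => 1 | S _ => INR a + 1 end) with n. simpl; field. }
  (* The terms with [M1] cancel, and [f * g1] cancels the quadratic term. What survives comes from
     differentiating the factor [1 + s], so its sign is the monotonicity of the weight. *)
  assert (HQ1 : forall s, 0 <= s ->
    n * s ^ a * (f s - n * M s) + s ^ S a * (f1 s - n * M1 s)
      + s ^ S a * M s * (n * s ^ a * M s + s ^ S a * M1 s) / 4 = s ^ S a * exp (g s)).
  { intros s Hs. rewrite Hf1e by exact Hs.
    pose proof (Hparts s) as Hp.
    replace (f s - n * M s) with (s * M1 s) by lra.
    replace (n * s ^ a * M s + s ^ S a * M1 s) with (s ^ a * f s) by (rewrite <- Hp; simpl; ring).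
    unfold g1. simpl. field. }
  assert (HQpos : forall s, 0 <= s -> 0 <= Q s).
  { intros s Hs. replace 0 with (Q 0) by (unfold Q; rewrite pow_i by lia; field).
    eapply derive_nonneg_le; [exact HQ| |exact Hs].
    intros x Hx. cbv beta. rewrite HQ1 by lra.
    apply Rmult_le_pos; [apply pow_le; lra|apply Rlt_le, exp_pos]. }
  (* [HB] says that [N' >= 0] below, as [Q s = s^(n+1) (M1 s + s^a (M s)^2 / 8)]. *)
  assert (HB : forall s, 0 < s -> 0 <= M1 s + s ^ a * M s ^ 2 / 8).
  { intros s Hs. specialize (HQpos s (Rlt_le _ _ Hs)).
    assert (Hp : 0 < s * s ^ S a) by (apply Rmult_lt_0_compat; [|apply pow_lt]; lra).
    apply Rmult_le_reg_l with (1 := Hp). rewrite Rmult_0_r.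
    replace (s * s ^ S a * (M1 s + s ^ a * M s ^ 2 / 8)) with (Q s); [exact HQpos|].
    unfold Q. rewrite <- (Hparts s). simpl. field. }
  (* For the standard bubble [v] is affine in [s^n] and [N] is constant. Here [N] only increases,
     which keeps [v] above that affine function. *)
  set (v := fun s => exp (- (g s / 2))).
  set (N := fun s => M s * v s).
  assert (Hv : forall s, is_derive v s (s ^ a * N s / 8)).
  { intros s. unfold N, v. auto_derive; [auto|]. rewrite Dg. unfold g1, Rdiv. field. }
  assert (Dv : forall x, Derive (fun y : R => v y) x = x ^ a * N x / 8)
    by (intros; now apply is_derive_unique).
  assert (Ev : forall x, ex_derive (fun y : R => v y) x) by (intros x; eexists; apply Hv).
  assert (HN : forall s, is_derive N s (v s * (M1 s + s ^ a * M s ^ 2 / 8))).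
  { intros s. unfold N. auto_derive; [auto|]. rewrite DM, Dv. unfold N. simpl. field. }
  assert (HNmono : forall s, 0 <= s -> N 0 <= N s).
  { intros s Hs. eapply derive_nonneg_le; [exact HN| |exact Hs].
    intros x Hx. apply Rmult_le_pos; [apply Rlt_le, exp_pos|now apply HB]. }
  assert (HN0 : N 0 = exp K / n * v 0).
  { unfold N. f_equal. pose proof (Hparts 0) as Hp. rewrite Hfe, Hg0 in Hp by lra.
    apply (Rmult_eq_reg_l n); [|lra]. transitivity (exp K); [lra|field; lra]. }
  assert (Hvlow : forall s, 0 <= s -> v 0 * (1 + exp K * s ^ S a / (8 * n ^ 2)) <= v s).
  { intros s Hs.
    (* The subtracted term is the antiderivative of [s^a * N 0 / 8], a lower bound for [v']. With
       [N 0 = exp K / n * v 0] it produces the constant [8 n^2]. *)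
    set (D := fun s => v s - N 0 * s ^ S a / (8 * n)).
    assert (HD : D 0 <= D s).
    { apply (derive_nonneg_le D (fun s => s ^ a * (N s - N 0) / 8)); [| |exact Hs].
      - intros x. unfold D. auto_derive; [auto|]. rewrite Dv.
        change (Init.Nat.pred (S a)) with a.
        change (match a with O => 1 | S _ => INR a + 1 end) with n. field; lra.
      - intros x Hx. pose proof (HNmono x ltac:(lra)).
        assert (0 <= x ^ a) by (apply pow_le; lra). nra. }
    unfold D in HD. rewrite pow_i in HD by lia. rewrite HN0 in HD.
    replace (v 0 * (1 + exp K * s ^ S a / (8 * n ^ 2)))
      with (v 0 - exp K / n * v 0 * 0 / (8 * n) + exp K / n * v 0 * s ^ S a / (8 * n))
      by (field; lra).
    lra. }
  exists g, g1, g2. split; [|split; [|split; [|split; [|split]]]].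
  - exact Hg0.
  - exact Hg.
  - intros s. unfold g1, g2. auto_derive; [auto|]. rewrite DM. unfold pred. field.
  - intros s; unfold g2. continuity_tac.
  - intros s Hs. rewrite Rmult_assoc, <- Hfe, <- Hparts by exact Hs. unfold g1, g2.
    assert (He : s * (INR a * s ^ Init.Nat.pred a) = INR a * s ^ a).
    { destruct a; [simpl; ring|]. change (Init.Nat.pred (S a)) with a. simpl pow. ring. }
    assert (Hna : n = INR a + 1) by apply S_INR.
    rewrite Hna.
    transitivity (- (s * (INR a * s ^ Init.Nat.pred a)) * M s + INR a * s ^ a * M s); [field|].
    rewrite He; ring.
  - intros s Hs. specialize (Hvlow s Hs).
    assert (Hpos : 0 < 1 + exp K * s ^ S a / (8 * n ^ 2)).
    { pose proof (exp_pos K). assert (0 <= s ^ S a) by now apply pow_le.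
      assert (0 < / (8 * n ^ 2)) by (apply Rinv_0_lt_compat; simpl; nra).
      unfold Rdiv. assert (0 <= exp K * s ^ S a) by nra. nra. }
    set (b := 1 + exp K * s ^ S a / (8 * n ^ 2)) in *.
    assert (Hsq : (v 0 * b) ^ 2 <= v s ^ 2).
    { apply pow_incr. split; [|exact Hvlow].
      apply Rmult_le_pos; [apply Rlt_le, exp_pos|lra]. }
    (* This identity turns the lower bound on [v] into the upper bound on [exp g]. *)
    assert (Hve : forall x, exp (g x) * v x ^ 2 = 1).
    { intros x. unfold v. simpl. rewrite Rmult_1_r, <- !exp_plus, <- exp_0. f_equal; field. }
    pose proof (Hve s) as Hvs. pose proof (Hve 0) as Hv0. rewrite Hg0 in Hv0.
    apply (Rmult_le_reg_r (b ^ 2)); [nra|].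
    replace (exp K / b ^ 2 * b ^ 2) with (exp K) by (field; lra).
    rewrite <- (Rmult_1_r (exp K)), <- Hvs.
    rewrite Rpow_mult_distr in Hsq.
    replace (exp (g s) * b ^ 2) with (exp K * exp (g s) * (v 0 ^ 2 * b ^ 2)).
    + replace (exp K * (exp (g s) * v s ^ 2)) with (exp K * exp (g s) * v s ^ 2) by ring.
      apply Rmult_le_compat_l; [|exact Hsq].
      apply Rmult_le_pos; apply Rlt_le, exp_pos.
    + transitivity ((exp K * v 0 ^ 2) * (exp (g s) * b ^ 2)); [ring|]. rewrite Hv0; ring.
Qed.

(** * The weight [1 + |x|^2] and its derivatives *)

(** A family closed under [dx] and [dy]: derivatives of every order reduce to rewriting the
    coefficients. *)
Definition quadratic (a b c d e : R) (x y : R) : R :=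
  a + b * x + c * y + d * x ^ 2 + e * y ^ 2.

Lemma dx_quadratic (a b c d e : R) :
  dx (quadratic a b c d e) = quadratic b (2 * d) 0 0 0.
Proof.
  apply functional_extensionality; intros x; apply functional_extensionality; intros y.
  unfold dx, quadratic. apply is_derive_unique. auto_derive; [exact I|ring].
Qed.

Lemma dy_quadratic (a b c d e : R) :
  dy (quadratic a b c d e) = quadratic c 0 (2 * e) 0 0.
Proof.
  apply functional_extensionality; intros x; apply functional_extensionality; intros y.
  unfold dy, quadratic. apply is_derive_unique. auto_derive; [exact I|ring].
Qed.

Lemma quadratic_smooth (D : R -> R -> Prop) (a b c d e : R) :
  smooth_on D (quadratic a b c d e).
Proof.
  assert (Hc : forall a b c d e x y, cont2_at (quadratic a b c d e) x y).
  { intros. unfold cont2_at, quadratic. continuity_tac. }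
  intros m; revert a b c d e; induction m as [|m IH]; intros a b c d e; simpl.
  - intros; apply Hc.
  - rewrite dx_quadratic, dy_quadratic. repeat split; auto.
    + unfold quadratic. auto_derive; exact I.
    + unfold quadratic. auto_derive; exact I.
Qed.

(** The derivatives in question are [2 x], [2 y], 2 or 0. The generous bound 4 is the value taken
    for [c1]. *)
Lemma weight_pderiv_bound (l : list bool) (x y : R) :
  inB1 x y -> (1 <= length l <= 3)%nat ->
  Rabs (pderiv l (quadratic 1 0 0 1 1) x y) <= 4.
Proof.
  intros Hxy Hl. unfold inB1 in Hxy.
  assert (Hx : -1 <= x <= 1) by nra. assert (Hy : -1 <= y <= 1) by nra.
  destruct l as [|b1 [|b2 [|b3 [|b4 l]]]]; simpl in Hl; try lia.
  all: destruct b1; try destruct b2; try destruct b3; cbn [pderiv];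
    repeat (rewrite dx_quadratic || rewrite dy_quadratic);
    unfold quadratic; apply Rabs_le; nra.
Qed.

(** * Partial derivatives of radial functions *)

Section RadialFunctions.

Variables g g1 g2 : R -> R.
Hypothesis Hg1 : forall s : R, is_derive g s (g1 s).
Hypothesis Hg2 : forall s : R, is_derive g1 s (g2 s).
Hypothesis Hg2c : forall s : R, continuous g2 s.

Let Dg (s : R) : Derive (fun t : R => g t) s = g1 s.
Proof. now apply is_derive_unique. Qed.
Let Dg1 (s : R) : Derive (fun t : R => g1 t) s = g2 s.
Proof. now apply is_derive_unique. Qed.
Let Eg (s : R) : ex_derive (fun t : R => g t) s.
Proof. eexists; apply Hg1. Qed.
Let Eg1 (s : R) : ex_derive (fun t : R => g1 t) s.
Proof. eexists; apply Hg2. Qed.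
Let Cg (s : R) : continuous g s.
Proof. exact (derive_continuous _ _ _ (Hg1 s)). Qed.
Let Cg1 (s : R) : continuous g1 s.
Proof. exact (derive_continuous _ _ _ (Hg2 s)). Qed.

Ltac derive2_tac :=
  let x := fresh in let y := fresh in
  apply functional_extensionality; intros x; apply functional_extensionality; intros y;
  apply is_derive_unique; auto_derive; [auto | rewrite ?Dg, ?Dg1; simpl; ring].

Lemma dx_radial :
  dx (fun x y => g (x ^ 2 + y ^ 2)) = fun x y => 2 * x * g1 (x ^ 2 + y ^ 2).
Proof. derive2_tac. Qed.

Lemma dy_radial :
  dy (fun x y => g (x ^ 2 + y ^ 2)) = fun x y => 2 * y * g1 (x ^ 2 + y ^ 2).
Proof. derive2_tac. Qed.

Lemma dxx_radial :
  dx (fun x y => 2 * x * g1 (x ^ 2 + y ^ 2)) =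
  fun x y => 2 * g1 (x ^ 2 + y ^ 2) + 4 * x ^ 2 * g2 (x ^ 2 + y ^ 2).
Proof. derive2_tac. Qed.

Lemma dyx_radial :
  dy (fun x y => 2 * x * g1 (x ^ 2 + y ^ 2)) = fun x y => 4 * x * y * g2 (x ^ 2 + y ^ 2).
Proof. derive2_tac. Qed.

Lemma dxy_radial :
  dx (fun x y => 2 * y * g1 (x ^ 2 + y ^ 2)) = fun x y => 4 * x * y * g2 (x ^ 2 + y ^ 2).
Proof. derive2_tac. Qed.

Lemma dyy_radial :
  dy (fun x y => 2 * y * g1 (x ^ 2 + y ^ 2)) =
  fun x y => 2 * g1 (x ^ 2 + y ^ 2) + 4 * y ^ 2 * g2 (x ^ 2 + y ^ 2).
Proof. derive2_tac. Qed.

(** Since the profile is a function of [|x|^2] and not of [|x|], the chain rule yields formulas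
    without division, continuous at the origin too. *)
Lemma radial_Ck2 (D : R -> R -> Prop) : Ck_on D 2 (fun x y => g (x ^ 2 + y ^ 2)).
Proof.
  cbn [Ck_on].
  rewrite dx_radial, dy_radial, dxx_radial, dyx_radial, dxy_radial, dyy_radial.
  unfold cont2_at.
  repeat match goal with |- _ /\ _ => split end; intros.
  all: try match goal with |- _ /\ _ => split end.
  all: try (auto_derive; now auto).
  all: continuity_tac.
Qed.

(** In the variable [s = |x|^2] the Laplacian is [4 (s g')'], the differential part of the radial
    equation. *)
Lemma lap_radial (x y : R) :
  lap (fun x y => g (x ^ 2 + y ^ 2)) x y =
  4 * (g1 (x ^ 2 + y ^ 2) + (x ^ 2 + y ^ 2) * g2 (x ^ 2 + y ^ 2)).
Proof. unfold lap. rewrite dx_radial, dy_radial, dxx_radial, dyy_radial. ring. Qed.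

End RadialFunctions.

(** * The mass bound through products of Lorentzians *)

(** The antiderivative [atan (t / d)] has range of length [PI] whatever the scale [d]; this
    uniformity keeps the mass bounded along the sequence. *)
Lemma RInt_lorentzian_le (d a b : R) :
  0 < d -> a <= b ->
  ex_RInt (fun t => d / (d ^ 2 + t ^ 2)) a b /\ RInt (fun t => d / (d ^ 2 + t ^ 2)) a b <= PI.
Proof.
  intros Hd Hab.
  assert (H : is_RInt (fun t => d / (d ^ 2 + t ^ 2)) a b (atan (b / d) - atan (a / d))).
  { apply (is_RInt_derive (fun t => atan (t / d)) (fun t => d / (d ^ 2 + t ^ 2))).
    - intros t _.
      replace (d / (d ^ 2 + t ^ 2)) with (scal (/ d) (/ (1 + (t / d) ^ 2))).
      + apply (is_derive_comp atan (fun t => t / d)).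
        * apply is_derive_Reals, derivable_pt_lim_atan.
        * auto_derive; [lra|field; lra].
      + change (/ d * / (1 + (t / d) ^ 2) = d / (d ^ 2 + t ^ 2)). field.
        assert (0 <= t ^ 2) by apply pow2_ge_0. repeat split; nra.
    - intros t _. apply (ex_derive_continuous (fun t => d / (d ^ 2 + t ^ 2))).
      auto_derive. assert (0 <= t * t) by apply Rle_0_sqr. nra. }
  split; [eexists; exact H|].
  rewrite (is_RInt_unique _ _ _ _ H).
  pose proof (atan_bound (b / d)). pose proof (atan_bound (a / d)). lra.
Qed.

(** A product majorant allows the iterated integral to be estimated one variable at a time, each
    contributing a factor [PI]. *)
Lemma int_B1_le_lorentzian (F : R -> R -> R) (C d : R) :
  (forall x y, continuous (fun p : R * R => F (fst p) (snd p)) (x, y)) ->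
  0 <= C -> 0 < d ->
  (forall x y, inB1 x y -> F x y <= C * (d / (d ^ 2 + x ^ 2)) * (d / (d ^ 2 + y ^ 2))) ->
  int_B1 F <= C * PI ^ 2.
Proof.
  intros HF HC Hd Hb. unfold int_B1.
  assert (HFc : forall x y, continuous (F x) y).
  { intros x y. apply (continuous_comp_2 (fun _ => x) (fun t => t) F).
    - apply continuous_const.
    - apply continuous_id.
    - apply HF. }
  assert (Hlor : forall x, 0 < d / (d ^ 2 + x ^ 2)).
  { intros x. apply Rdiv_lt_0_compat; [exact Hd|]. pose proof (pow2_ge_0 x). nra. }
  (* The substitution [y = sqrt (1 - x^2) t] fixes the moving limits. The new integrand is
     continuous for all real [x], as [sqrt] is 0 on negative arguments. *)
  assert (Hex : ex_RInt (fun x => RInt (fun y => F x y) (- sqrt (1 - x ^ 2)) (sqrt (1 - x ^ 2)))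
                  (-1) 1).
  { apply (ex_RInt_ext
      (fun x => RInt (fun t => sqrt (1 - x ^ 2) * F x (sqrt (1 - x ^ 2) * t)) (-1) 1)).
    - intros x _.
      transitivity (RInt (F x) (sqrt (1 - x ^ 2) * (-1)) (sqrt (1 - x ^ 2) * 1)).
      + apply (RInt_comp (F x) (fun t => sqrt (1 - x ^ 2) * t) (fun _ => sqrt (1 - x ^ 2))).
        * intros; apply HFc.
        * intros t _; split; [auto_derive; [exact I|simpl; ring]|apply continuous_const].
      + replace (sqrt (1 - x ^ 2) * -1) with (- sqrt (1 - x ^ 2)) by ring.
        now rewrite Rmult_1_r.
    - apply ex_RInt_of_continuous.
      apply (continuous_RInt_param
        (fun x t => sqrt (1 - x ^ 2) * F x (sqrt (1 - x ^ 2) * t))).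
      intros x t. pose proof continuous_sqrt as Hs.
      apply continuous_R_mult; [continuity_tac|].
      apply (continuous_comp_2 (fun p : R * R => fst p)
        (fun p : R * R => sqrt (1 - fst p ^ 2) * snd p) F); [continuity_tac|continuity_tac|].
      apply HF. }
  eapply Rle_trans.
  - apply (RInt_le _ (fun x => C * PI * (d / (d ^ 2 + x ^ 2)))); [lra|exact Hex| |].
    + apply (ex_RInt_scal (fun x => d / (d ^ 2 + x ^ 2)) (-1) 1 (C * PI)).
      apply RInt_lorentzian_le; lra.
    + intros x Hx. pose proof (sqrt_pos (1 - x ^ 2)) as Hsq.
      assert (Hle : - sqrt (1 - x ^ 2) <= sqrt (1 - x ^ 2)) by lra.
      destruct (RInt_lorentzian_le d _ _ Hd Hle) as [Hi1 Hi2].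
      eapply Rle_trans.
      * apply (RInt_le _ (fun y => C * (d / (d ^ 2 + x ^ 2)) * (d / (d ^ 2 + y ^ 2))));
          [exact Hle| | |].
        -- now apply ex_RInt_of_continuous.
        -- now apply (ex_RInt_scal (fun y => d / (d ^ 2 + y ^ 2)) _ _
             (C * (d / (d ^ 2 + x ^ 2)))).
        -- intros y Hy. apply Hb. unfold inB1.
           assert (H1 : sqrt (1 - x ^ 2) * sqrt (1 - x ^ 2) = 1 - x ^ 2)
             by (apply sqrt_sqrt; nra).
           nra.
      * assert (He : RInt (fun y => C * (d / (d ^ 2 + x ^ 2)) * (d / (d ^ 2 + y ^ 2)))
            (- sqrt (1 - x ^ 2)) (sqrt (1 - x ^ 2)) =
          C * (d / (d ^ 2 + x ^ 2)) * RInt (fun y => d / (d ^ 2 + y ^ 2))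
            (- sqrt (1 - x ^ 2)) (sqrt (1 - x ^ 2)))
          by exact (RInt_scal (fun y => d / (d ^ 2 + y ^ 2)) _ _
                      (C * (d / (d ^ 2 + x ^ 2))) Hi1).
        rewrite He. specialize (Hlor x).
        replace (C * PI * (d / (d ^ 2 + x ^ 2))) with (C * (d / (d ^ 2 + x ^ 2)) * PI) by ring.
        apply Rmult_le_compat_l; [|exact Hi2].
        apply Rmult_le_pos; lra.
  - destruct (RInt_lorentzian_le d (-1) 1 Hd ltac:(lra)) as [Hi1 Hi2].
    assert (He : RInt (fun x => C * PI * (d / (d ^ 2 + x ^ 2))) (-1) 1 =
      C * PI * RInt (fun x => d / (d ^ 2 + x ^ 2)) (-1) 1)
      by exact (RInt_scal (fun y => d / (d ^ 2 + y ^ 2)) _ _ (C * PI) Hi1).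
    rewrite He. replace (C * PI ^ 2) with (C * PI * PI) by ring.
    apply Rmult_le_compat_l; [|exact Hi2].
    apply Rmult_le_pos; [exact HC|]. pose proof PI_RGT_0; lra.
Qed.

(** For [t <= 1] the left side is at most 4. For [t > 1], [1 + t <= 2 t] and [t^a <= t^(2a)] bound
    it by [4 t^(2a+2)]. *)
Lemma pow_bubble_le (a : nat) (t : R) :
  0 <= t -> t ^ a * (1 + t) ^ 2 <= 4 * (1 + t ^ S a) ^ 2.
Proof.
  intros Ht. destruct (Rle_dec t 1) as [H1|H1].
  - assert (t ^ a <= 1) by (rewrite <- (pow1 a); now apply pow_incr).
    assert (0 <= t ^ a) by now apply pow_le.
    assert (0 <= t ^ S a) by now apply pow_le.
    assert ((1 + t) ^ 2 <= 4) by nra.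
    assert (0 <= (1 + t) ^ 2) by apply pow2_ge_0.
    nra.
  - assert (Hp : 1 <= t ^ a) by (apply pow_R1_Rle; lra).
    simpl (t ^ S a).
    assert (t <= t * t ^ a) by nra.
    assert (t ^ a <= t ^ a * t ^ a) by nra.
    assert ((1 + t) ^ 2 <= 4 * (t * t)) by nra.
    assert (t ^ a * (1 + t) ^ 2 <= (t ^ a * t ^ a) * (4 * (t * t))).
    { apply Rmult_le_compat; (lra || apply pow2_ge_0). }
    nra.
Qed.

(** [d] is the length scale of the bubble, fixed by [exp K * d^(2n) = 1]. In the variable
    [t = s / d^2] the density depends on [K] only through a factor [1 / d^2]. *)
Lemma bubble_le_lorentzian (a : nat) (K x y : R) :
  let n := INR (S a) in
  let d := exp (- K / (2 * n)) in
  let s := x ^ 2 + y ^ 2 in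
  s ^ a * (exp K / (1 + exp K * s ^ S a / (8 * n ^ 2)) ^ 2)
  <= 4 * (8 * n ^ 2) ^ 2 * (d / (d ^ 2 + x ^ 2)) * (d / (d ^ 2 + y ^ 2)).
Proof.
  intros n d s.
  assert (Hn : 1 <= n) by (unfold n; rewrite S_INR; pose proof (pos_INR a); lra).
  assert (Hd : 0 < d) by apply exp_pos.
  assert (HE : exp K * (d ^ 2) ^ S a = 1).
  { unfold d. rewrite <- pow_mult.
    assert (Hpow : forall m z, exp z ^ m = exp (INR m * z)).
    { induction m as [|m IH]; intros z; [simpl; rewrite Rmult_0_l, exp_0; ring|].
      rewrite S_INR. simpl. rewrite IH, <- exp_plus. f_equal; ring. }
    rewrite Hpow, <- exp_plus, <- exp_0. f_equal. rewrite mult_INR. fold n.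
    simpl (INR 2). field. lra. }
  assert (Hs : 0 <= s) by (unfold s; nra).
  set (t := s / d ^ 2).
  assert (Ht : 0 <= t) by (apply Rmult_le_pos; [exact Hs|apply Rlt_le, Rinv_0_lt_compat; nra]).
  assert (Hst : s = d ^ 2 * t) by (unfold t; field; lra).
  assert (Hx : 0 < d ^ 2 + x ^ 2) by nra.
  assert (Hy : 0 < d ^ 2 + y ^ 2) by nra.
  set (c := / (8 * n ^ 2)).
  assert (Hc : 0 < c <= 1).
  { unfold c. split; [apply Rinv_0_lt_compat; nra|].
    rewrite <- Rinv_1. apply Rinv_le_contravar; nra. }
  assert (Htn : 0 <= t ^ S a) by now apply pow_le.
  assert (Hb : 1 + exp K * s ^ S a / (8 * n ^ 2) = 1 + c * t ^ S a).
  { rewrite Hst, Rpow_mult_distr. unfold c.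
    replace (exp K * ((d ^ 2) ^ S a * t ^ S a)) with ((exp K * (d ^ 2) ^ S a) * t ^ S a) by ring.
    rewrite HE. field. lra. }
  rewrite Hb.
  assert (Hsa : s ^ a * exp K = t ^ a / d ^ 2).
  { rewrite Hst, Rpow_mult_distr. rewrite <- (Rmult_1_r (t ^ a / d ^ 2)), <- HE. simpl. field. lra. }
  assert (Hbpos : 0 < 1 + c * t ^ S a) by nra.
  (* Each factor is at most [d^2 + s]; here radial decay is traded for a product in [x] and [y]. *)
  assert (Hden : (d ^ 2 + x ^ 2) * (d ^ 2 + y ^ 2) <= (d ^ 2) ^ 2 * (1 + t) ^ 2).
  { replace ((d ^ 2) ^ 2 * (1 + t) ^ 2) with ((d ^ 2 + d ^ 2 * t) ^ 2) by ring.
    rewrite <- Hst. unfold s.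
    assert (0 <= x ^ 2) by apply pow2_ge_0. assert (0 <= y ^ 2) by apply pow2_ge_0.
    assert (0 <= d ^ 2) by apply pow2_ge_0. nra. }
  (* Since [c <= 1], the bubble constant can be pulled out of the denominator at the cost of the
     factor [(8 n^2)^2]. *)
  assert (Hcb : c ^ 2 * (1 + t ^ S a) ^ 2 <= (1 + c * t ^ S a) ^ 2).
  { rewrite <- Rpow_mult_distr. apply pow_incr. nra. }
  pose proof (pow_bubble_le a t Ht) as Hpb.
  replace (s ^ a * (exp K / (1 + c * t ^ S a) ^ 2)) with (s ^ a * exp K / (1 + c * t ^ S a) ^ 2)
    by (field; lra).
  rewrite Hsa.
  replace (8 * n ^ 2) with (/ c) by (unfold c; field; lra).
  set (P := (d ^ 2 + x ^ 2) * (d ^ 2 + y ^ 2)) in *.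
  set (b := (1 + c * t ^ S a) ^ 2) in *.
  assert (Hbp : 0 < b) by (unfold b; nra).
  assert (HP : 0 < P) by (unfold P; now apply Rmult_lt_0_compat).
  replace (4 * (/ c) ^ 2 * (d / (d ^ 2 + x ^ 2)) * (d / (d ^ 2 + y ^ 2)))
    with (4 * d ^ 2 / c ^ 2 / P) by (unfold P; field; repeat split; lra).
  apply (Rmult_le_reg_r (d ^ 2 * b * P * c ^ 2)).
  { repeat apply Rmult_lt_0_compat; nra. }
  replace (t ^ a / d ^ 2 / b * (d ^ 2 * b * P * c ^ 2)) with (t ^ a * P * c ^ 2)
    by (field; repeat split; lra).
  replace (4 * d ^ 2 / c ^ 2 / P * (d ^ 2 * b * P * c ^ 2)) with (4 * (d ^ 2) ^ 2 * b)
    by (field; repeat split; lra).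
  assert (Hta : 0 <= t ^ a) by now apply pow_le.
  apply Rle_trans with (t ^ a * ((d ^ 2) ^ 2 * (1 + t) ^ 2) * c ^ 2).
  - apply Rmult_le_compat_r; [apply pow2_ge_0|]. now apply Rmult_le_compat_l.
  - replace (t ^ a * ((d ^ 2) ^ 2 * (1 + t) ^ 2) * c ^ 2)
      with ((d ^ 2) ^ 2 * c ^ 2 * (t ^ a * (1 + t) ^ 2)) by ring.
    apply Rle_trans with ((d ^ 2) ^ 2 * c ^ 2 * (4 * (1 + t ^ S a) ^ 2)).
    + apply Rmult_le_compat_l; [|exact Hpb].
      apply Rmult_le_pos; apply pow2_ge_0.
    + replace ((d ^ 2) ^ 2 * c ^ 2 * (4 * (1 + t ^ S a) ^ 2))
        with (4 * (d ^ 2) ^ 2 * (c ^ 2 * (1 + t ^ S a) ^ 2)) by ring.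
      apply Rmult_le_compat_l; [|exact Hcb].
      pose proof (pow2_ge_0 (d ^ 2)). lra.
Qed.

(** * The Laplacian of the logarithm of the weight *)

Lemma dx_ln_weight :
  dx (fun x y => ln (quadratic 1 0 0 1 1 x y)) =
  fun x y => 2 * x / (1 + x ^ 2 + y ^ 2).
Proof.
  apply functional_extensionality; intros x; apply functional_extensionality; intros y.
  unfold dx, quadratic. apply is_derive_unique. auto_derive; [nra|field; nra].
Qed.

Lemma dy_ln_weight :
  dy (fun x y => ln (quadratic 1 0 0 1 1 x y)) =
  fun x y => 2 * y / (1 + x ^ 2 + y ^ 2).
Proof.
  apply functional_extensionality; intros x; apply functional_extensionality; intros y.
  unfold dy, quadratic. apply is_derive_unique. auto_derive; [nra|field; nra].
Qed.

Lemma lap_ln_weight : lap (fun x y => ln (quadratic 1 0 0 1 1 x y)) 0 0 = 4.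
Proof.
  unfold lap. rewrite dx_ln_weight, dy_ln_weight.
  replace 4 with (2 + 2) by ring. f_equal.
  - apply is_derive_unique. auto_derive; [lra|field].
  - apply is_derive_unique. auto_derive; [lra|field].
Qed.

(** * Assembly of the blow-up sequence from the radial profiles *)

Theorem theorem1p2 (alpha : nat) :
  exists c c1 : R, 0 < c /\ 0 < c1 /\
  exists h u : nat -> R -> R -> R,
    (forall k, smooth_on inB1 (h k)) /\
    (forall k, Ck_on inB1 2 (u k) /\
               (forall x y, inB1bar x y -> cont2_within inB1bar (u k) x y)) /\
    (forall k x y, inB1 x y ->
       lap (u k) x y + (x ^ 2 + y ^ 2) ^ alpha * h k x y * exp (u k x y) = 0) /\
    (* (i) *)
    (forall k x y, inB1 x y ->
       / c1 <= h k x y <= c1 /\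
       forall l : list bool, (1 <= length l <= 3)%nat ->
         Rabs (pderiv l (h k) x y) <= c1) /\
    (* (ii) *)
    (forall k, c <= Rabs (lap (fun x y => ln (h k x y)) 0 0)) /\
    (* (iii) *)
    blowup_only_at_origin u /\ spherical_harnack u /\
    (* (iv) *)
    (exists C : R, 0 < C /\
       forall k,
         (forall x1 y1 x2 y2, x1 ^ 2 + y1 ^ 2 = 1 -> x2 ^ 2 + y2 ^ 2 = 1 ->
            Rabs (u k x1 y1 - u k x2 y2) <= C) /\
         int_B1 (fun x y => (x ^ 2 + y ^ 2) ^ alpha * h k x y * exp (u k x y)) <= C).
Proof.
  set (n := INR (S alpha)).
  assert (Hn : 1 <= n) by (unfold n; rewrite S_INR; pose proof (pos_INR alpha); lra).
  (* One profile of height [k] is chosen for each [k]. Its derivatives remain existential, because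
     only [g] enters the definition of [u]. *)
  destruct (functional_choice (fun (k : nat) (g : R -> R) => exists g1 g2 : R -> R,
    g 0 = INR k /\
    (forall s : R, is_derive g s (g1 s)) /\ (forall s : R, is_derive g1 s (g2 s)) /\
    (forall s : R, continuous g2 s) /\
    (forall s, 0 <= s -> 4 * (g1 s + s * g2 s) + s ^ alpha * (1 + s) * exp (g s) = 0) /\
    (forall s, 0 <= s ->
       exp (g s) <= exp (INR k) / (1 + exp (INR k) * s ^ S alpha / (8 * n ^ 2)) ^ 2)))
    as [g Hg].
  { intros k. exact (radial_solution alpha (INR k)). }
  assert (Hgc : forall k (s : R), continuous (g k) s).
  { intros k s. destruct (Hg k) as (g1 & g2 & _ & H1 & _).
    exact (derive_continuous _ _ _ (H1 s)). }
  (* The difference is zero; 1 is merely a convenient positive constant. *)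
  assert (Hcirc : forall k x1 y1 x2 y2, x1 ^ 2 + y1 ^ 2 = x2 ^ 2 + y2 ^ 2 ->
    Rabs (g k (x1 ^ 2 + y1 ^ 2) - g k (x2 ^ 2 + y2 ^ 2)) <= 1).
  { intros k x1 y1 x2 y2 ->. rewrite Rminus_diag, Rabs_R0; lra. }
  (* The first 4 is the Laplacian of the log-weight at 0. The second bounds the weight, which lies
     in [[1, 2)] on the disk, and its derivatives. *)
  exists 4, 4. split; [lra|]. split; [lra|].
  exists (fun _ => quadratic 1 0 0 1 1), (fun k x y => g k (x ^ 2 + y ^ 2)).
  split; [|split; [|split; [|split; [|split; [|split; [|split]]]]]].
  - intros k. apply quadratic_smooth.
  - intros k. destruct (Hg k) as (g1 & g2 & _ & H1 & H2 & H3 & _). split.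
    + exact (radial_Ck2 _ _ _ H1 H2 H3 inB1).
    + intros x y _. unfold cont2_within.
      apply (filterlim_filter_le_1 (G := within _ (locally (x, y))) (F := locally (x, y)));
        [apply filter_le_within|].
      assert (Hc : continuous (fun p : R * R => g k (fst p ^ 2 + snd p ^ 2)) (x, y)).
      { pose proof (Hgc k). continuity_tac. }
      exact Hc.
  - intros k x y _. destruct (Hg k) as (g1 & g2 & _ & H1 & H2 & _ & H4 & _).
    rewrite (lap_radial _ _ _ H1 H2).
    transitivity (4 * (g1 (x ^ 2 + y ^ 2) + (x ^ 2 + y ^ 2) * g2 (x ^ 2 + y ^ 2)) +
      (x ^ 2 + y ^ 2) ^ alpha * (1 + (x ^ 2 + y ^ 2)) * exp (g k (x ^ 2 + y ^ 2))).
    + unfold quadratic. ring.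
    + apply H4. nra.
  - intros k x y Hxy. unfold inB1 in Hxy.
    split; [unfold quadratic; nra|].
    intros l Hl. now apply weight_pderiv_bound.
  - intros k. rewrite lap_ln_weight, Rabs_pos_eq; lra.
  - split.
    (* The origin itself serves as every blow-up point, since [u k 0 0 = k]. *)
    + exists (fun _ => 0), (fun _ => 0).
      split; [intros; unfold inB1; lra|].
      split; [apply is_lim_seq_const|]. split; [apply is_lim_seq_const|].
      apply (is_lim_seq_ext INR); [|apply is_lim_seq_INR].
      intros k. replace (0 ^ 2 + 0 ^ 2) with 0 by ring.
      destruct (Hg k) as (g1 & g2 & H0 & _). now rewrite H0.
    (* With [E = exp k >= 1] and [s >= r^2], the bubble is at most [E / (E q)^2 <= 1 / q^2], free of
       [k]. The inequality [1 + u <= exp u] passes the bound on to [u]. *)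
    + intros r Hr. set (q := (r ^ 2) ^ S alpha / (8 * n ^ 2)).
      assert (Hq : 0 < q).
      { apply Rdiv_lt_0_compat; [apply pow_lt; nra|nra]. }
      exists (/ q ^ 2). intros k x y Hxy.
      destruct (Hg k) as (g1 & g2 & _ & _ & _ & _ & _ & H5).
      set (s := x ^ 2 + y ^ 2) in *.
      assert (Hs : 0 <= s) by (unfold s; nra). specialize (H5 s Hs).
      pose proof (exp_ineq1_le (g k s)) as He.
      enough (exp (INR k) / (1 + exp (INR k) * s ^ S alpha / (8 * n ^ 2)) ^ 2 <= / q ^ 2) by lra.
      assert (HE : 1 <= exp (INR k)).
      { pose proof (exp_ineq1_le (INR k)). pose proof (pos_INR k). lra. }
      assert (Hb : exp (INR k) * q <= 1 + exp (INR k) * s ^ S alpha / (8 * n ^ 2)).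
      { assert (q <= s ^ S alpha / (8 * n ^ 2)).
        { apply Rmult_le_compat_r; [apply Rlt_le, Rinv_0_lt_compat; nra|].
          apply pow_incr. nra. }
        unfold Rdiv. rewrite Rmult_assoc. fold (s ^ S alpha / (8 * n ^ 2)). nra. }
      set (b := 1 + exp (INR k) * s ^ S alpha / (8 * n ^ 2)) in *.
      assert (Hb2 : (exp (INR k) * q) ^ 2 <= b ^ 2) by (apply pow_incr; nra).
      assert (0 < exp (INR k) * q) by nra.
      apply (Rmult_le_reg_r (b ^ 2 * q ^ 2)); [apply Rmult_lt_0_compat; nra|].
      replace (exp (INR k) / b ^ 2 * (b ^ 2 * q ^ 2)) with (exp (INR k) * q ^ 2)
        by (field; nra).
      replace (/ q ^ 2 * (b ^ 2 * q ^ 2)) with (b ^ 2) by (field; lra).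
      rewrite Rpow_mult_distr in Hb2.
      assert (0 < q ^ 2) by nra. nra.
  - exists 1. split; [lra|]. intros k r x1 y1 x2 y2 _ H1 H2. apply Hcirc. lra.
  - assert (HC : 0 < 2 * (4 * (8 * n ^ 2) ^ 2) * PI ^ 2).
    { pose proof PI_RGT_0. apply Rmult_lt_0_compat; [|nra].
      assert (0 < 8 * n ^ 2) by nra. nra. }
    (* The summand 1 covers the oscillation on the unit circle. In the other summand, 2 bounds the
       weight, [4 * (8 n^2)^2] comes from the bubble, and [PI^2] from the two integrations. *)
    exists (1 + 2 * (4 * (8 * n ^ 2) ^ 2) * PI ^ 2). split; [lra|]. intros k. split.
    + intros x1 y1 x2 y2 H1 H2. pose proof (Hcirc k x1 y1 x2 y2 ltac:(lra)). lra.
    + eapply Rle_trans.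
      * apply (int_B1_le_lorentzian _ (2 * (4 * (8 * n ^ 2) ^ 2)) (exp (- INR k / (2 * n)))).
        -- intros x y. unfold quadratic. pose proof (Hgc k). continuity_tac.
        -- pose proof (pow2_ge_0 (8 * n ^ 2)). lra.
        -- apply exp_pos.
        -- intros x y Hxy. unfold inB1 in Hxy.
           destruct (Hg k) as (g1 & g2 & _ & _ & _ & _ & _ & H5).
           pose proof (bubble_le_lorentzian alpha (INR k) x y) as Hbl.
           cbv zeta in Hbl. fold n in Hbl.
           assert (Hs : 0 <= x ^ 2 + y ^ 2) by nra. specialize (H5 _ Hs).
           assert (Hsa : 0 <= (x ^ 2 + y ^ 2) ^ alpha) by now apply pow_le.
           assert (Hq : 0 <= quadratic 1 0 0 1 1 x y <= 2) by (unfold quadratic; nra).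
           pose proof (exp_pos (g k (x ^ 2 + y ^ 2))) as Hep.
           set (L := exp (- INR k / (2 * n)) / (exp (- INR k / (2 * n)) ^ 2 + x ^ 2)) in *.
           set (L' := exp (- INR k / (2 * n)) / (exp (- INR k / (2 * n)) ^ 2 + y ^ 2)) in *.
           apply Rle_trans with (2 * ((x ^ 2 + y ^ 2) ^ alpha * exp (g k (x ^ 2 + y ^ 2)))).
           { assert (0 <= (x ^ 2 + y ^ 2) ^ alpha * exp (g k (x ^ 2 + y ^ 2)))
               by (apply Rmult_le_pos; lra).
             nra. }
           assert ((x ^ 2 + y ^ 2) ^ alpha * exp (g k (x ^ 2 + y ^ 2)) <=
             4 * (8 * n ^ 2) ^ 2 * L * L').
           { eapply Rle_trans; [|exact Hbl]. now apply Rmult_le_compat_l. }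
           lra.
      * lra.
Qed.
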